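(* For all density matrices $\rho_{AB}$ on $\mathcal H_A\otimes\mathcal H_B$ and $\sigma_{A'B'}$ on $\mathcal H_{A'}\otimes\mathcal H_{B'}$, regarding $\rho_{AB}\otimes\sigma_{A'B'}$ as a bipartite state between $AA'$ and $BB'$, we have $\mu_{\mathrm{ent}}(\rho_{AB}\otimes\sigma_{A'B'})=\max\{\mu_{\mathrm{ent}}(\rho_{AB}),\mu_{\mathrm{ent}}(\sigma_{A'B'})\}$.
   Context: All Hilbert spaces are finite-dimensional. For a bipartite density matrix $\rho_{AB}$ with reduced states $\rho_A,\rho_B$, the maximal correlation is $\mu(\rho_{AB})=\max |\mathrm{tr}(\rho_{AB}\, X_A\otimes Y_B^\dagger)|$ over $X_A\in\mathbf L(\mathcal H_A)$, $Y_B\in\mathbf L(\mathcal H_B)$ with $\mathrm{tr}(\rho_A X_A)=\mathrm{tr}(\rho_B Y_B)=0$ and $\mathrm{tr}(\rho_A X_AX_A^\dagger)=\mathrm{tr}(\rho_B Y_BY_B^\dagger)=1$. The maximal entanglement is $\mu_{\mathrm{ent}}(\rho_{AB})=\inf \max_i \mu(\tau^{(i)}_{AB})$, the infimum over all decompositions $\rho_{AB}=\sum_i p_i\tau^{(i)}_{AB}$ with $p_i\ge0$ and $\tau^{(i)}_{AB}$ density matrices. *)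

(* Defs.v *)
From HB Require Import structures.
From mathcomp Require Import all_boot all_order all_algebra.
From mathcomp Require Import complex mxtens.
From mathcomp Require Import all_classical all_reals.

Set Implicit Arguments.
Unset Strict Implicit.
Unset Printing Implicit Defensive.

Import Order.TTheory GRing.Theory Num.Theory.
Local Open Scope ring_scope.
Local Open Scope classical_set_scope.

Section QDefs.
Variable R : realType.
Local Notation C := R[i].

Definition adj {m n : nat} (A : 'M[C]_(m, n)) : 'M[C]_(n, m) :=
  (map_mx Num.conj A)^T.

Definition cmod (z : C) : R := complex.Re `|z|.

Definition psd {n : nat} (A : 'M[C]_n) : Prop :=
  adj A = A /\ forall v : 'cV[C]_n, 0 <= (adj v *m A *m v) ord0 ord0.

Definition density {n : nat} (A : 'M[C]_n) : Prop := psd A /\ \tr A = 1.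

(* bipartite operators on H_A (x) H_B live in 'M_(m * n), indices
   paired by mxtens_index (the convention of tensmx, A *t B).      *)
Definition ptraceB {m n : nat} (rho : 'M[C]_(m * n)) : 'M[C]_m :=
  \matrix_(i, j) \sum_(k < n) rho (mxtens_index (i, k)) (mxtens_index (j, k)).

Definition ptraceA {m n : nat} (rho : 'M[C]_(m * n)) : 'M[C]_n :=
  \matrix_(i, j) \sum_(k < m) rho (mxtens_index (k, i)) (mxtens_index (k, j)).

Definition corr_values {m n : nat} (rho : 'M[C]_(m * n)) : set R :=
  [set r | exists (X : 'M[C]_m) (Y : 'M[C]_n),
     [/\ \tr (ptraceB rho *m X) = 0, \tr (ptraceA rho *m Y) = 0,
         \tr (ptraceB rho *m (X *m adj X)) = 1,
         \tr (ptraceA rho *m (Y *m adj Y)) = 1 &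
         r = cmod (\tr (rho *m (X *t adj Y)))]].

(* maximal correlation (the max is attained; sup set0 = 0 by convention) *)
Definition max_corr {m n : nat} (rho : 'M[C]_(m * n)) : R :=
  sup (corr_values rho).

Definition ment_values {m n : nat} (rho : 'M[C]_(m * n)) : set R :=
  [set r | exists (k : nat) (p : 'I_k -> R) (tau : 'I_k -> 'M[C]_(m * n)),
     [/\ forall i, 0 <= p i, forall i, density (tau i),
         rho = \sum_(i < k) ((p i)%:C)%C *: tau i &
         r = \big[Num.max/0]_(i < k) max_corr (tau i)]].

Definition max_ent {m n : nat} (rho : 'M[C]_(m * n)) : R :=
  inf (ment_values rho).

Definition regroup {a b a' b' : nat} (M : 'M[C]_((a * b) * (a' * b'))) :
    'M[C]_((a * a') * (b * b')) :=
  \matrix_(i, j)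
    let: (ia, ib) := mxtens_unindex i in
    let: (ja, jb) := mxtens_unindex j in
    let: (x, x') := mxtens_unindex ia in
    let: (y, y') := mxtens_unindex ib in
    let: (z, z') := mxtens_unindex ja in
    let: (w, w') := mxtens_unindex jb in
    M (mxtens_index (mxtens_index (x, y), mxtens_index (x', y')))
      (mxtens_index (mxtens_index (z, w), mxtens_index (z', w'))).

End QDefs.

(* Main.v *)
Require Import Defs.
From HB Require Import structures.
From mathcomp Require Import all_boot all_order all_algebra.
From mathcomp Require Import complex mxtens.
From mathcomp Require Import ring.
From mathcomp Require Import all_classical all_reals.
Import Order.TTheory GRing.Theory Num.Theory.
Local Open Scope ring_scope.

(**
   Write a density matrix as rho = K K^*.  The rows of K give linear functionals phi_k on
   operators of A and psi_k on operators of B with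
     tr(rho (X (x) Y^* )) = sum_k phi_k(X) conj(psi_k(Y)),
     tr(rho_A X X^* ) = sum_k |phi_k(X)|^2,   tr(rho_B Y Y^* ) = sum_k |psi_k(Y)|^2.
   To bound mu(tau (x) omega), apply the functionals of omega to the second tensor factor of X
   and Y: this yields slices x_k, y_k on the first factor with F(X,Y) = sum_k f(x_k, y_k), where
   F and f are the correlation forms of tau (x) omega and tau.  Centering x_k and y_k splits F
   into sum_k f(x_k^0, y_k^0), controlled by mu(tau), and the correlation under omega of the
   partial means of X and Y, controlled by mu(omega); the norms split the same way, so
   mu(tau (x) omega) <= max(mu(tau), mu(omega)).  Tensoring decompositions of rho and sigma gives
   one inequality.  For the other, X |-> X (x) 1 shows that mu does not increase under partial
   trace, so a decomposition of rho (x) sigma traces down to equally good ones of rho and sigma.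
*)

(** * Sums and traces over tensor-product indices *)

Lemma sum_mxtens (V : nmodType) (m n : nat) (F : 'I_(m * n) -> V) :
  \sum_x F x = \sum_(i < m) \sum_(j < n) F (mxtens_index (i, j)).
Proof.
rewrite pair_big /= (reindex (@mxtens_index m n)) /=; last first.
  by exists (@mxtens_unindex m n) => x _; rewrite ?mxtens_indexK ?mxtens_unindexK.
by apply: eq_bigr => -[].
Qed.

Lemma exchange_big3 (V : nmodType) (I J T : finType) (F : I -> J -> T -> V) :
  \sum_i \sum_j \sum_t F i j t = \sum_t \sum_i \sum_j F i j t.
Proof. by under eq_bigr do rewrite exchange_big; rewrite exchange_big. Qed.

Lemma tr_mulmxE (S : pzRingType) (m n : nat) (A : 'M[S]_(m, n)) (B : 'M_(n, m)) :
  \tr (A *m B) = \sum_p \sum_q A p q * B q p.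
Proof. by apply: eq_bigr => p _; rewrite mxE. Qed.

Section Correlation.
Set Implicit Arguments.
Unset Strict Implicit.
Unset Printing Implicit Defensive.
Variable R : realType.
Local Notation C := R[i].

(** * Adjoints, and partial traces as pairings *)

Lemma adjE (m n : nat) (A : 'M[C]_(m, n)) i j : adj A i j = (A j i)^*.
Proof. by rewrite !mxE. Qed.

Lemma adj_tens (m n p q : nat) (A : 'M[C]_(m, n)) (B : 'M[C]_(p, q)) :
  adj (A *t B) = adj A *t adj B.
Proof. by rewrite /adj map_mxT trmx_tens. Qed.

Lemma adj1 (n : nat) : adj (1%:M : 'M[C]_n) = 1%:M.
Proof. by rewrite /adj map_mx1 trmx1. Qed.

Lemma adj_mul (m n p : nat) (A : 'M[C]_(m, n)) (B : 'M[C]_(n, p)) :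
  adj (A *m B) = adj B *m adj A.
Proof. by rewrite /adj map_mxM trmx_mul. Qed.

Lemma adjK (m n : nat) (A : 'M[C]_(m, n)) : adj (adj A) = A.
Proof. by apply/matrixP => i j; rewrite !adjE conjCK. Qed.

Lemma tr_tens (m n : nat) (rho : 'M[C]_(m * n)) (X : 'M_m) (Y : 'M_n) :
  \tr (rho *m (X *t Y)) =
  \sum_i \sum_j \sum_k \sum_l
    rho (mxtens_index (i, j)) (mxtens_index (k, l)) * (X k i * Y l j).
Proof.
rewrite tr_mulmxE sum_mxtens; do 2![apply: eq_bigr => ? _].
by rewrite sum_mxtens; do 2![apply: eq_bigr => ? _]; rewrite tensmxE.
Qed.

Lemma tr_ptraceB (m n : nat) (rho : 'M[C]_(m * n)) (X : 'M_m) :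
  \tr (ptraceB rho *m X) = \tr (rho *m (X *t 1%:M)).
Proof.
rewrite tr_tens tr_mulmxE; apply: eq_bigr => i _.
rewrite [RHS]exchange_big; apply: eq_bigr => k _ /=.
rewrite mxE mulr_suml; apply: eq_bigr => j _.
rewrite (bigD1 j) //= big1 ?addr0 ?mxE ?eqxx ?mulr1 // => l /negPf lj.
by rewrite mxE lj !mulr0.
Qed.

Lemma tr_ptraceA (m n : nat) (rho : 'M[C]_(m * n)) (Y : 'M_n) :
  \tr (ptraceA rho *m Y) = \tr (rho *m (1%:M *t Y)).
Proof.
rewrite tr_tens tr_mulmxE [RHS]exchange_big; apply: eq_bigr => j _ /=.
under [RHS]eq_bigr => i _ do rewrite exchange_big /=.
rewrite [RHS]exchange_big; apply: eq_bigr => l _ /=.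
rewrite mxE mulr_suml; apply: eq_bigr => i _.
rewrite (bigD1 i) //= big1 ?addr0 ?mxE ?eqxx ?mul1r // => k /negPf ki.
by rewrite mxE ki mul0r mulr0.
Qed.

(** * Gram families and the functionals [phi] *)

Definition gram (n : nat) (T : finType) (G : 'M[C]_n) (w : T -> 'I_n -> C) :=
  forall p q, G p q = \sum_t w t p * (w t q)^*.

(* The functionals of the header are [phi (w t) i], indexed by the pairs (t, i). *)
Definition phi (n : nat) (w : 'I_n -> C) (i : 'I_n) (X : 'M[C]_n) : C :=
  \sum_q (w q)^* * X q i.

(** [G] is the sum of the rank-one matrices w_t w_t^*, and [phi (w t) i Z] is the i-th entry of the
    row w_t^* Z. Each rank-one term therefore contributes the inner product of the rows w_t^* Z and
    w_t^* Z'. *)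
Lemma gram_dot (n : nat) (T : finType) (G : 'M[C]_n) (w : T -> 'I_n -> C) Z Z' :
  gram G w ->
  \tr (G *m (Z *m adj Z')) = \sum_t \sum_i phi (w t) i Z * (phi (w t) i Z')^*.
Proof.
move=> Gw; rewrite tr_mulmxE.
under eq_bigr => p _ do under eq_bigr => q _ do
  (rewrite Gw mulr_suml; under eq_bigr => t _ do rewrite mxE mulr_sumr).
rewrite exchange_big3; apply: eq_bigr => t _.
rewrite exchange_big3; apply: eq_bigr => i _.
rewrite /phi rmorph_sum mulr_sumr; apply: eq_bigr => p _.
rewrite mulr_suml; apply: eq_bigr => q _.
rewrite adjE rmorphM /= conjCK; ring.
Qed.

(* For rho = K K^*, the functional (s, l, i) is [phi (famA K (s, l)) i] on A and
   [phi (famB K (s, i)) l] on B, with s a column of K and l, i basis indices of B and A. *)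
Definition famA (m n r : nat) (K : 'M[C]_(m * n, r)) (t : 'I_r * 'I_n) (k : 'I_m) :=
  K (mxtens_index (k, t.2)) t.1.
Definition famB (m n r : nat) (K : 'M[C]_(m * n, r)) (t : 'I_r * 'I_m) (k : 'I_n) :=
  K (mxtens_index (t.2, k)) t.1.

Lemma gram_famA (m n r : nat) (K : 'M[C]_(m * n, r)) :
  gram (ptraceB (K *m adj K)) (famA K).
Proof.
move=> p q; rewrite mxE.
rewrite -(pair_bigA _ (fun s l => famA K (s, l) p * (famA K (s, l) q)^*)) /=.
rewrite exchange_big; apply: eq_bigr => l _ /=; rewrite mxE.
by apply: eq_bigr => s _; rewrite adjE.
Qed.

Lemma gram_famB (m n r : nat) (K : 'M[C]_(m * n, r)) :
  gram (ptraceA (K *m adj K)) (famB K).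
Proof.
move=> p q; rewrite mxE.
rewrite -(pair_bigA _ (fun s i => famB K (s, i) p * (famB K (s, i) q)^*)) /=.
rewrite exchange_big; apply: eq_bigr => l _ /=; rewrite mxE.
by apply: eq_bigr => s _; rewrite adjE.
Qed.

(** [X] contracts the A index of the conjugated copy of column s, and the adjoint of [Y] the B index
    of the other copy. This leaves free one index i of A and one index l of B, so (s, l, i) labels
    both functionals, with i and l exchanging roles between [famA] and [famB]. *)
Lemma corr_phi (m n r : nat) (K : 'M[C]_(m * n, r)) X Y :
  \tr ((K *m adj K) *m (X *t adj Y)) =
  \sum_s \sum_l \sum_i phi (famA K (s, l)) i X * (phi (famB K (s, i)) l Y)^*.
Proof.
rewrite tr_tens.
under eq_bigr => i _ do under eq_bigr => j _ do (under eq_bigr => k _ do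
  (under eq_bigr => l _ do rewrite mxE mulr_suml; rewrite exchange_big /=);
  rewrite exchange_big /=).
rewrite exchange_big3; apply: eq_bigr => s _.
under eq_bigr => i _ do under eq_bigr => j _ do rewrite exchange_big /=.
rewrite exchange_big3; apply: eq_bigr => l _.
apply: eq_bigr => i _.
rewrite /phi rmorph_sum mulr_sumr; apply: eq_bigr => j _.
rewrite mulr_suml; apply: eq_bigr => k _.
rewrite /famA /famB !adjE rmorphM /= conjCK; ring.
Qed.

(** * Contracting one tensor factor *)

Definition slice (m n : nat) (X : 'M[C]_(m * n)) p q : 'M[C]_n :=
  \matrix_(u, v) X (mxtens_index (p, u)) (mxtens_index (q, v)).
(** The map id (x) [phi w i]. Its values are the slices x_k, y_k of the header, whereas
    [slice X p q] is a block of [X]. *)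
Definition contr (m n : nat) (w : 'I_n -> C) (i : 'I_n) (X : 'M[C]_(m * n)) : 'M[C]_m :=
  \matrix_(p, q) phi w i (slice X p q).

(** Written in blocks of [X], the left side is a combination, with coefficients [P p q], of pairings
    of blocks under [Q]. [gram_dot] expands these pairings, and for fixed t and i the terms form a
    norm under [P]. *)
Lemma tens_dot (m n : nat) (T : finType) (P : 'M[C]_m) (Q : 'M[C]_n) (w : T -> 'I_n -> C) X :
  gram Q w ->
  \tr ((P *t Q) *m (X *m adj X)) =
  \sum_t \sum_i \tr (P *m (contr (w t) i X *m adj (contr (w t) i X))).
Proof.
move=> Qw.
transitivity (\sum_p \sum_q P p q *
   \sum_v \tr (Q *m (slice X q v *m adj (slice X p v)))).
  rewrite tr_mulmxE sum_mxtens; apply: eq_bigr => p _.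
  under eq_bigr => p' _ do rewrite sum_mxtens.
  rewrite exchange_big; apply: eq_bigr => q _ /=.
  under [X in _ = _ * X]eq_bigr => v _ do rewrite tr_mulmxE.
  rewrite -[X in _ = _ * X]exchange_big3.
  rewrite mulr_sumr; apply: eq_bigr => p' _ /=.
  rewrite mulr_sumr; apply: eq_bigr => q' _ /=.
  rewrite tensmxE -mulrA; congr (_ * _).
  rewrite mxE sum_mxtens mulr_sumr; apply: eq_bigr => v _.
  rewrite mxE; congr (_ * _); apply: eq_bigr => v' _.
  by rewrite !adjE !mxE.
under eq_bigr => p _ do under eq_bigr => q _ do
  (under eq_bigr => v _ do rewrite (gram_dot _ _ Qw); rewrite -exchange_big3;
   rewrite mulr_sumr; under eq_bigr => t _ do rewrite mulr_sumr).
rewrite exchange_big3; apply: eq_bigr => t _.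
rewrite exchange_big3; apply: eq_bigr => i _.
rewrite tr_mulmxE; do 2![apply: eq_bigr => ? _].
congr (_ * _); rewrite mxE; apply: eq_bigr => v _.
by rewrite adjE !mxE.
Qed.

Lemma regroupE (a b a' b' : nat) (M : 'M[C]_((a * b) * (a' * b')))
    i i' j j' k k' l l' :
  regroup M (mxtens_index (mxtens_index (i, i'), mxtens_index (j, j')))
    (mxtens_index (mxtens_index (k, k'), mxtens_index (l, l'))) =
  M (mxtens_index (mxtens_index (i, j), mxtens_index (i', j')))
    (mxtens_index (mxtens_index (k, l), mxtens_index (k', l'))).
Proof. by rewrite mxE !mxtens_indexK. Qed.

(** For fixed indices of [tau], the second state sees only one block of [X] and one of [Y], to which
    [corr_phi] applies. This is the identity F(X,Y) = sum_k f(x_k, y_k) of the header. *)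
Lemma corr_tens (a b a' b' r : nat) (tau : 'M[C]_(a * b)) (K : 'M[C]_(a' * b', r)) X Y :
  \tr (regroup (tau *t (K *m adj K)) *m (X *t adj Y)) =
  \sum_s \sum_l \sum_i
    \tr (tau *m (contr (famA K (s, l)) i X *t adj (contr (famB K (s, i)) l Y))).
Proof.
transitivity (\sum_i \sum_j \sum_k \sum_l
    tau (mxtens_index (i, j)) (mxtens_index (k, l)) *
    \tr ((K *m adj K) *m (slice X k i *t adj (slice Y j l)))).
  rewrite tr_tens sum_mxtens; apply: eq_bigr => i _.
  under eq_bigr => i' _ do rewrite sum_mxtens.
  rewrite exchange_big; apply: eq_bigr => j _ /=.
  under eq_bigr => i' _ do under eq_bigr => j' _ do rewrite sum_mxtens.
  rewrite exchange_big3; apply: eq_bigr => k _ /=.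
  under eq_bigr => i' _ do (under eq_bigr => j' _ do
    (under eq_bigr => k' _ do rewrite sum_mxtens); rewrite exchange_big3).
  rewrite exchange_big; apply: eq_bigr => l _ /=.
  rewrite tr_tens; do 4![rewrite mulr_sumr; apply: eq_bigr => ? _].
  by rewrite regroupE tensmxE !adjE !mxE mulrA.
under eq_bigr => i _ do under eq_bigr => j _ do under eq_bigr => k _ do
  under eq_bigr => l _ do rewrite corr_phi mulr_sumr.
(* Three rounds follow, moving the indices s, l and i of [corr_phi] in turn outside the four sums
   over the entries of [tau]. *)
under eq_bigr => i _ do (under eq_bigr => j _ do
  (rewrite exchange_big3); rewrite exchange_big /=).
rewrite exchange_big; apply: eq_bigr => s _ /=.
under eq_bigr => i _ do under eq_bigr => j _ do under eq_bigr => k _ do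
  under eq_bigr => l _ do rewrite mulr_sumr.
under eq_bigr => i _ do (under eq_bigr => j _ do
  (rewrite exchange_big3); rewrite exchange_big /=).
rewrite exchange_big; apply: eq_bigr => l' _ /=.
under eq_bigr => i _ do under eq_bigr => j _ do under eq_bigr => k _ do
  under eq_bigr => l _ do rewrite mulr_sumr.
under eq_bigr => i _ do (under eq_bigr => j _ do
  (rewrite exchange_big3); rewrite exchange_big /=).
rewrite exchange_big; apply: eq_bigr => i' _ /=.
rewrite tr_tens; do 4![apply: eq_bigr => ? _].
by rewrite adjE !mxE.
Qed.

(** The partial mean: tr(P .) (x) id applied to [X]. *)
Definition mean (m n : nat) (P : 'M[C]_m) (X : 'M[C]_(m * n)) : 'M[C]_n :=
  \sum_p \sum_q P p q *: slice X q p.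

(** The two factors may be contracted in either order. Hence the means removed when centering the
    contractions are the functionals of a single operator, the partial mean. *)
Lemma mean_phi (m n : nat) (P : 'M[C]_m) (w : 'I_n -> C) i (X : 'M[C]_(m * n)) :
  phi w i (mean P X) = \tr (P *m contr w i X).
Proof.
rewrite tr_mulmxE /phi.
under eq_bigr => u _ do (rewrite summxE mulr_sumr;
  under eq_bigr => p _ do rewrite summxE mulr_sumr).
rewrite -exchange_big3; apply: eq_bigr => p _; apply: eq_bigr => q _.
rewrite mxE /phi mulr_sumr; apply: eq_bigr => u _.
by rewrite mxE mulrCA.
Qed.

Lemma tr_mean (m n : nat) (P : 'M[C]_m) (Q : 'M[C]_n) (X : 'M[C]_(m * n)) :
  \tr (Q *m mean P X) = \tr ((P *t Q) *m X).
Proof.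
rewrite /mean mulmx_sumr raddf_sum /= tr_mulmxE sum_mxtens; apply: eq_bigr => p _.
rewrite mulmx_sumr raddf_sum /=.
under [RHS]eq_bigr => u _ do rewrite sum_mxtens.
rewrite [RHS]exchange_big; apply: eq_bigr => q _ /=.
rewrite -scalemxAr mxtraceZ tr_mulmxE.
do 2![rewrite mulr_sumr; apply: eq_bigr => ? _].
by rewrite tensmxE mxE mulrA.
Qed.

Lemma ptraceB_tens (a b a' b' : nat) (tau : 'M[C]_(a * b)) (om : 'M[C]_(a' * b')) :
  ptraceB (regroup (tau *t om)) = ptraceB tau *t ptraceB om.
Proof.
apply/matrixP => x y.
case: (mxtens_indexP x) => i i'; case: (mxtens_indexP y) => k k'.
rewrite tensmxE !mxE sum_mxtens big_distrlr /=.
by do 2![apply: eq_bigr => ? _]; rewrite regroupE tensmxE.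
Qed.

Lemma ptraceA_tens (a b a' b' : nat) (tau : 'M[C]_(a * b)) (om : 'M[C]_(a' * b')) :
  ptraceA (regroup (tau *t om)) = ptraceA tau *t ptraceA om.
Proof.
apply/matrixP => x y.
case: (mxtens_indexP x) => i i'; case: (mxtens_indexP y) => k k'.
rewrite tensmxE !mxE sum_mxtens big_distrlr /=.
by do 2![apply: eq_bigr => ? _]; rewrite regroupE tensmxE.
Qed.

(** * Centering: variance and covariance identities *)

Definition center (n : nat) (P X : 'M[C]_n) : 'M[C]_n := X - (\tr (P *m X))%:M.

Lemma adjB (m n : nat) (A B : 'M[C]_(m, n)) : adj (A - B) = adj A - adj B.
Proof. by apply/matrixP => i j; rewrite !mxE rmorphB. Qed.

Lemma adjZ (m n : nat) c (A : 'M[C]_(m, n)) : adj (c *: A) = c^* *: adj A.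
Proof. by apply/matrixP => i j; rewrite !mxE rmorphM. Qed.

Lemma adj_scalar (n : nat) (c : C) : adj (c%:M : 'M_n) = c^*%:M.
Proof. by apply/matrixP => i j; rewrite !mxE rmorphMn eq_sym. Qed.

Lemma tr_adj (n : nat) (A : 'M[C]_n) : \tr (adj A) = (\tr A)^*.
Proof. by rewrite rmorph_sum; apply: eq_bigr => i _; rewrite adjE. Qed.

Lemma center_mean (n : nat) (P X : 'M[C]_n) : \tr P = 1 -> \tr (P *m center P X) = 0.
Proof. by move=> trP; rewrite mulmxBr mul_mx_scalar raddfB /= mxtraceZ trP mulr1 subrr. Qed.

(** The variance decomposition. As [P] is Hermitian, the mean of the adjoint of [X] is the conjugate
    of the mean of [X], so the cross terms combine. *)
Lemma center_dot (n : nat) (P X : 'M[C]_n) : adj P = P -> \tr P = 1 ->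
  \tr (P *m (X *m adj X)) =
  \tr (P *m (center P X *m adj (center P X))) + \tr (P *m X) * (\tr (P *m X))^*.
Proof.
move=> hP trP; rewrite /center; set e := \tr (P *m X).
have eE : \tr (P *m adj X) = e^*.
  by rewrite mxtrace_mulC -{1}hP -adj_mul tr_adj.
rewrite adjB adj_scalar mulmxBl !mulmxBr mul_mx_scalar !mul_scalar_mx.
rewrite scale_scalar_mx -!scalemxAr mul_mx_scalar !raddfB /= !mxtraceZ eE trP -/e.
ring.
Qed.

Lemma tens11 (m n : nat) : (1%:M : 'M[C]_m) *t (1%:M : 'M[C]_n) = 1%:M.
Proof.
apply/matrixP => x y.
case: (mxtens_indexP x) => i i'; case: (mxtens_indexP y) => k k'.
rewrite tensmxE !mxE (can_eq (@mxtens_indexK _ _)) xpair_eqE.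
by rewrite -natrM mulnb.
Qed.

(** The covariance counterpart of [center_dot]: the cross terms have an identity on one side, so
    they only involve the means under the marginals. *)
Lemma center_corr (m n : nat) (rho : 'M[C]_(m * n)) X Y : adj rho = rho -> \tr rho = 1 ->
  \tr (rho *m (X *t adj Y)) =
  \tr (rho *m (center (ptraceB rho) X *t adj (center (ptraceA rho) Y))) +
  \tr (ptraceB rho *m X) * (\tr (ptraceA rho *m Y))^*.
Proof.
move=> hrho trrho; rewrite /center; set e := \tr (ptraceB rho *m X).
set f := \tr (ptraceA rho *m Y).
have fE : \tr (rho *m (1%:M *t adj Y)) = f^*.
  by rewrite /f tr_ptraceA -tr_adj adj_mul mxtrace_mulC adj_tens adj1 hrho.
have eE : \tr (rho *m (X *t 1%:M)) = e by rewrite /e tr_ptraceB.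
have tE : \tr (rho *m (1%:M *t 1%:M)) = 1.
  by rewrite tens11 mulmx1.
have -> : (X - e%:M) *t adj (Y - f%:M) =
   X *t adj Y - e *: (1%:M *t adj Y) - f^* *: (X *t 1%:M) + (e * f^*) *: (1%:M *t 1%:M).
  apply/matrixP => x y; rewrite adjB adj_scalar !mxE; ring.
rewrite mulmxDr !mulmxBr -!scalemxAr raddfD !raddfB /= !mxtraceZ fE eE tE; ring.
Qed.

(** * Positive semidefinite matrices and their factors *)

Lemma psd_mul_adj (n r : nat) (K : 'M[C]_(n, r)) : psd (K *m adj K).
Proof.
split=> [|v]; first by rewrite adj_mul adjK.
have -> : adj v *m (K *m adj K) *m v = adj (adj K *m v) *m (adj K *m v).
  by rewrite adj_mul adjK !mulmxA.
rewrite mxE; apply: sumr_ge0 => i _.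
by rewrite adjE mulrC -normCK exprn_ge0.
Qed.

(** By the spectral theorem A = P^* D P with P unitary, and K = P^* sqrt(D) is a factor. *)
Lemma psd_factor (n : nat) (A : 'M[C]_n) : psd A -> exists K : 'M[C]_n, A = K *m adj K.
Proof.
move=> [hA posA].
have hermA : A \is hermsymmx.
  by apply/is_hermitianmxP; rewrite expr0 scale1r -{1}hA; apply/matrixP => i j; rewrite !mxE.
have /orthomx_spectralP := hermitian_normalmx hermA.
set P := spectralmx A; set d := spectral_diag A => AE.
have adjP : invmx P = adj P.
  by rewrite invmx_unitary ?spectral_unitarymx //; apply/matrixP => i j; rewrite !mxE.
have uP : P \in unitmx by exact: spectral_unit.
have dE : diag_mx d = P *m A *m adj P by rewrite AE -adjP !mulmxA mulmxV // mul1mx mulmxK.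
(* The i-th eigenvalue is the quadratic form of [A] at the i-th column of P^*. *)
have d_ge0 i : 0 <= d 0 i.
  have := posA (adj P *m delta_mx i ord0).
  rewrite adj_mul adjK !mulmxA -(mulmxA _ P) -(mulmxA _ _ (adj P)) -dE.
  have -> : adj (delta_mx i ord0 : 'cV[C]_n) = delta_mx ord0 i.
    by apply/matrixP => x y; rewrite !mxE andbC rmorph_nat.
  by rewrite -rowE -colE !mxE eqxx mulr1n.
exists (adj P *m diag_mx (map_mx sqrtC d)).
rewrite adj_mul adjK mulmxA -(mulmxA (adj P)).
have -> : adj (diag_mx (map_mx sqrtC d)) = diag_mx (map_mx sqrtC d).
  apply/matrixP => x y; rewrite !mxE eq_sym rmorphMn /= geC0_conj ?sqrtC_ge0 //.
  by case: eqP => [->|].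
rewrite mulmx_diag {1}AE adjP; congr (_ *m diag_mx _ *m _).
by apply/rowP => i; rewrite !mxE -expr2 sqrtCK.
Qed.

Lemma adj_ptraceB (m n : nat) (rho : 'M[C]_(m * n)) :
  adj rho = rho -> adj (ptraceB rho) = ptraceB rho.
Proof.
move=> h; apply/matrixP => i j; rewrite adjE !mxE rmorph_sum.
by apply: eq_bigr => k _; rewrite /= -adjE h.
Qed.

Lemma adj_ptraceA (m n : nat) (rho : 'M[C]_(m * n)) :
  adj rho = rho -> adj (ptraceA rho) = ptraceA rho.
Proof.
move=> h; apply/matrixP => i j; rewrite adjE !mxE rmorph_sum.
by apply: eq_bigr => k _; rewrite /= -adjE h.
Qed.

Lemma tr_ptraceB1 (m n : nat) (rho : 'M[C]_(m * n)) : \tr (ptraceB rho) = \tr rho.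
Proof. by rewrite -[ptraceB rho]mulmx1 tr_ptraceB tens11 mulmx1. Qed.

Lemma tr_ptraceA1 (m n : nat) (rho : 'M[C]_(m * n)) : \tr (ptraceA rho) = \tr rho.
Proof. by rewrite -[ptraceA rho]mulmx1 tr_ptraceA tens11 mulmx1. Qed.

(** * Cauchy-Schwarz and the bound by the maximal correlation *)

Lemma mulr2_le_sqr (x y : C) : 0 <= x -> 0 <= y -> x * y *+ 2 <= x ^+ 2 + y ^+ 2.
Proof.
move=> x0 y0; rewrite -subr_ge0.
have -> : x ^+ 2 + y ^+ 2 - x * y *+ 2 = (x - y) ^+ 2 by ring.
by rewrite real_exprn_even_ge0 // rpredB ?ger0_real.
Qed.

Lemma dot_ge0 (n : nat) (T : finType) (G : 'M[C]_n) (w : T -> 'I_n -> C) (X : 'M_n) :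
  gram G w -> 0 <= \tr (G *m (X *m adj X)).
Proof.
move=> Gw; rewrite (gram_dot _ _ Gw); apply: sumr_ge0 => t _; apply: sumr_ge0 => i _.
by rewrite -normCK exprn_ge0.
Qed.

(** The norm is the sum of the squared moduli of the functionals. This handles operators of norm 0,
    which cannot be normalized. *)
Lemma dot_eq0 (n : nat) (T : finType) (G : 'M[C]_n) (w : T -> 'I_n -> C) (X : 'M_n) t i :
  gram G w -> \tr (G *m (X *m adj X)) = 0 -> phi (w t) i X = 0.
Proof.
move=> Gw; rewrite (gram_dot _ _ Gw) => /eqP.
rewrite psumr_eq0 => [|t' _]; last first.
  by apply: sumr_ge0 => i' _; rewrite -normCK exprn_ge0.
move=> /allP/(_ t); rewrite mem_index_enum /= => /(_ isT).
rewrite psumr_eq0 => [|i' _]; last by rewrite -normCK exprn_ge0.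
move=> /allP/(_ i); rewrite mem_index_enum /= => /(_ isT).
by rewrite -normCK sqrf_eq0 normr_eq0 => /eqP.
Qed.

(* AM-GM form of Cauchy-Schwarz, which adds up over slices without square roots. *)
Lemma corr_cauchy (m n : nat) (rho : 'M[C]_(m * n)) X Y : psd rho ->
  `|\tr (rho *m (X *t adj Y))| *+ 2 <=
  \tr (ptraceB rho *m (X *m adj X)) + \tr (ptraceA rho *m (Y *m adj Y)).
Proof.
move=> /psd_factor[K ->]; rewrite corr_phi.
rewrite (gram_dot _ _ (gram_famA K)) (gram_dot _ _ (gram_famB K)).
rewrite -(pair_bigA _ (fun s l =>
  \sum_i phi (famA K (s, l)) i X * (phi (famA K (s, l)) i X)^*)) /=.
rewrite -(pair_bigA _ (fun s i =>
  \sum_l phi (famB K (s, i)) l Y * (phi (famB K (s, i)) l Y)^*)) /=.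
rewrite -big_split /=.
apply: le_trans (_ : (\sum_s \sum_l \sum_i
  `|phi (famA K (s, l)) i X * (phi (famB K (s, i)) l Y)^*|) *+ 2 <= _).
  rewrite lerMn2r /=; apply: le_trans (ler_norm_sum _ _ _) _; apply: ler_sum => s _.
  apply: le_trans (ler_norm_sum _ _ _) _; apply: ler_sum => l _.
  exact: ler_norm_sum.
rewrite -sumrMnl; apply: ler_sum => s _.
rewrite [X in _ <= _ + X]exchange_big -big_split -sumrMnl; apply: ler_sum => l _ /=.
rewrite -big_split -sumrMnl; apply: ler_sum => i _ /=.
by rewrite normrM norm_conjC -!normCK mulr2_le_sqr.
Qed.

Lemma cmodE (z : C) : `|z| = (cmod z)%:C%C.
Proof. by rewrite /cmod normc_def. Qed.

(** This provides the boundedness needed for elements of [corr_values rho] to lie below its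
    [sup]. *)
Lemma corr_values_le1 (m n : nat) (rho : 'M[C]_(m * n)) :
  psd rho -> ubound (corr_values rho) 1.
Proof.
move=> hrho r [X [Y [_ _ NX NY ->]]].
have := corr_cauchy X Y hrho; rewrite NX NY -mulr2n lerMn2r /= cmodE.
by rewrite -(rmorph1 (real_complex R)) lecR.
Qed.

Lemma max_corr_ge0 (m n : nat) (rho : 'M[C]_(m * n)) : 0 <= max_corr rho.
Proof.
(* A set without a supremum, such as the empty set, has [sup] equal to 0. *)
rewrite /max_corr; have [|/sup_out -> //] := pselect (has_sup (corr_values rho)).
move=> [[r rin] /ub_le_sup r_le]; apply: le_trans (r_le _ rin).
case: rin => X [Y [_ _ _ _ ->]].
by rewrite -lecR -cmodE rmorph0.
Qed.

Lemma corr_eq0l (m n : nat) (rho : 'M[C]_(m * n)) X Y : psd rho ->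
  \tr (ptraceB rho *m (X *m adj X)) = 0 -> \tr (rho *m (X *t adj Y)) = 0.
Proof.
move=> /psd_factor[K ->] NX; rewrite corr_phi.
do 3![apply: big1 => ? _].
by rewrite (dot_eq0 _ _ (gram_famA K) NX) mul0r.
Qed.

Lemma corr_eq0r (m n : nat) (rho : 'M[C]_(m * n)) X Y : psd rho ->
  \tr (ptraceA rho *m (Y *m adj Y)) = 0 -> \tr (rho *m (X *t adj Y)) = 0.
Proof.
move=> /psd_factor[K ->] NY; rewrite corr_phi.
do 3![apply: big1 => ? _].
by rewrite (dot_eq0 _ _ (gram_famB K) NY) rmorph0 mulr0.
Qed.

Lemma dotZ (n : nat) (G X : 'M[C]_n) (c : C) : 0 <= c ->
  \tr (G *m ((c *: X) *m adj (c *: X))) = c ^+ 2 * \tr (G *m (X *m adj X)).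
Proof.
by move=> c0; rewrite adjZ -scalemxAl -!scalemxAr !mxtraceZ geC0_conj // mulrA.
Qed.

(** Rescaling both operators to unit norm bounds the correlation by mu sqrt(NX) sqrt(NY), and 2
    sqrt(NX) sqrt(NY) <= NX + NY. If a norm is 0, the correlation vanishes. The additive form can be
    summed over slices. *)
Lemma corr_bound (m n : nat) (rho : 'M[C]_(m * n)) X Y : psd rho ->
  \tr (ptraceB rho *m X) = 0 -> \tr (ptraceA rho *m Y) = 0 ->
  `|\tr (rho *m (X *t adj Y))| *+ 2 <=
  (max_corr rho)%:C%C *
  (\tr (ptraceB rho *m (X *m adj X)) + \tr (ptraceA rho *m (Y *m adj Y))).
Proof.
move=> hrho X0 Y0; have [K rhoE] := psd_factor hrho.
have mu_ge0 : 0 <= (max_corr rho)%:C%C :> C by rewrite ler0c max_corr_ge0.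
have gA := gram_famA K; have gB := gram_famB K; rewrite -rhoE in gA gB.
have NX_ge0 := dot_ge0 X gA; have NY_ge0 := dot_ge0 Y gB.
have [NX|NX_neq0] := eqVneq (\tr (ptraceB rho *m (X *m adj X))) 0.
  by rewrite corr_eq0l // normr0 mul0rn mulr_ge0 ?addr_ge0.
have [NY|NY_neq0] := eqVneq (\tr (ptraceA rho *m (Y *m adj Y))) 0.
  by rewrite corr_eq0r // normr0 mul0rn mulr_ge0 ?addr_ge0.
set NX := \tr _ in NX_ge0 NX_neq0 *; set NY := \tr _ in NY_ge0 NY_neq0 *.
pose s := sqrtC NX; pose t := sqrtC NY.
have s_gt0 : 0 < s by rewrite sqrtC_gt0 lt_def NX_neq0.
have t_gt0 : 0 < t by rewrite sqrtC_gt0 lt_def NY_neq0.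
have le_mu : cmod (\tr (rho *m ((s^-1 *: X) *t adj (t^-1 *: Y)))) <= max_corr rho.
  apply: ub_le_sup; first by exists 1; exact: corr_values_le1.
  exists (s^-1 *: X), (t^-1 *: Y); split => //.
  - by rewrite -scalemxAr mxtraceZ X0 mulr0.
  - by rewrite -scalemxAr mxtraceZ Y0 mulr0.
  - by rewrite dotZ ?invr_ge0 ?ltW // exprVn sqrtCK mulVf.
  - by rewrite dotZ ?invr_ge0 ?ltW // exprVn sqrtCK mulVf.
move: le_mu; rewrite -lecR -cmodE.
have -> : (s^-1 *: X) *t adj (t^-1 *: Y) = (s * t)^-1 *: (X *t adj Y).
  apply/matrixP => x y; rewrite adjZ !mxE geC0_conj ?invr_ge0 ?ltW // invfM; ring.
have st_gt0 : 0 < s * t by rewrite mulr_gt0.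
rewrite -scalemxAr mxtraceZ normrM (ger0_norm (ltW _)) ?invr_gt0 //.
rewrite mulrC ler_pdivrMr // => le_st.
apply: le_trans (_ : (max_corr rho)%:C%C * (s * t *+ 2) <= _).
  by rewrite mulrnAr lerMn2r.
by rewrite ler_wpM2l // -(sqrtCK NX) -(sqrtCK NY) mulr2_le_sqr ?ltW.
Qed.

(** * Maximal correlation of a tensor product *)

Lemma tens_dot_split (m n : nat) (T : finType) (P : 'M[C]_m) (Q : 'M[C]_n)
    (w : T -> 'I_n -> C) X :
  adj P = P -> \tr P = 1 -> gram Q w ->
  \tr ((P *t Q) *m (X *m adj X)) =
  \sum_t \sum_i \tr (P *m (center P (contr (w t) i X) *m
                           adj (center P (contr (w t) i X)))) +
  \tr (Q *m (mean P X *m adj (mean P X))).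
Proof.
move=> hP trP Qw; rewrite (tens_dot _ _ Qw) (gram_dot _ _ Qw) -big_split /=.
apply: eq_bigr => t _; rewrite -big_split; apply: eq_bigr => i _ /=.
(* The squared means left by centering are the squared functionals of [mean P X], which [gram_dot]
   sums to its norm under [Q]. *)
by rewrite center_dot // !mean_phi.
Qed.

Lemma max_corr_tens (a b a' b' : nat) (tau : 'M[C]_(a * b)) (om : 'M[C]_(a' * b')) :
  density tau -> density om ->
  max_corr (regroup (tau *t om)) <= Num.max (max_corr tau) (max_corr om).
Proof.
move=> [ptau trtau] [pom trom]; set lam := Num.max _ _.
have lam_ge0 : 0 <= lam by rewrite le_max max_corr_ge0.
have [K omE] := psd_factor pom; have [htau _] := ptau.
have gA := gram_famA K; have gB := gram_famB K; rewrite -omE in gA gB.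
have hA := adj_ptraceB htau; have hB := adj_ptraceA htau.
have trA : \tr (ptraceB tau) = 1 by rewrite tr_ptraceB1.
have trB : \tr (ptraceA tau) = 1 by rewrite tr_ptraceA1.
rewrite /max_corr; set S := corr_values _.
(* Without admissible pairs the maximal correlation is 0 by convention. *)
have [->|/set0P ne] := eqVneq S set0; first by rewrite sup0.
apply: ge_sup => // _ [X [Y [EX EY NX NY ->]]].
(* Centering of [X] and [Y] becomes centering of their partial means under [om], as [corr_bound]
   will require. *)
rewrite ptraceB_tens -tr_mean in EX; rewrite ptraceA_tens -tr_mean in EY.
rewrite ptraceB_tens in NX; rewrite ptraceA_tens in NY.
pose x s l i := center (ptraceB tau) (contr (famA K (s, l)) i X).
pose y s l i := center (ptraceA tau) (contr (famB K (s, i)) l Y).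
pose X' := mean (ptraceB tau) X; pose Y' := mean (ptraceA tau) Y.
have NXE : \sum_s \sum_l \sum_i \tr (ptraceB tau *m (x s l i *m adj (x s l i))) +
    \tr (ptraceB om *m (X' *m adj X')) = 1.
  rewrite -[RHS]NX (tens_dot_split _ _ _ gA) //.
  congr (_ + _).
  by rewrite pair_bigA; apply: eq_bigr => -[].
have NYE : \sum_s \sum_l \sum_i \tr (ptraceA tau *m (y s l i *m adj (y s l i))) +
    \tr (ptraceA om *m (Y' *m adj Y')) = 1.
  rewrite -[RHS]NY (tens_dot_split _ _ _ gB) //.
  congr (_ + _).
  under eq_bigr do rewrite exchange_big /=.
  by rewrite pair_bigA; apply: eq_bigr => -[].
have FE : \tr (regroup (tau *t om) *m (X *t adj Y)) =
    \sum_s \sum_l \sum_i \tr (tau *m (x s l i *t adj (y s l i))) +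
    \tr (om *m (X' *t adj Y')).
  rewrite omE corr_tens corr_phi.
  do 3![rewrite -big_split /=; apply: eq_bigr => ? _].
  by rewrite !mean_phi center_corr.
rewrite -lecR -cmodE.
suff : `|\tr (regroup (tau *t om) *m (X *t adj Y))| *+ 2 <= lam%:C%C *+ 2 by rewrite lerMn2r.
rewrite FE.
(* The two unit norms [NXE] and [NYE] add up to 2; splitting this 2 gives each slice correlation the
   two norms that bound it. *)
have -> : lam%:C%C *+ 2 = lam%:C%C *
   (\sum_s \sum_l \sum_i (\tr (ptraceB tau *m (x s l i *m adj (x s l i))) +
      \tr (ptraceA tau *m (y s l i *m adj (y s l i)))) +
    (\tr (ptraceB om *m (X' *m adj X')) + \tr (ptraceA om *m (Y' *m adj Y')))).
  under eq_bigr do under eq_bigr do rewrite big_split /=.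
  under eq_bigr do rewrite big_split /=.
  by rewrite big_split /= addrACA NXE NYE mulr2n mulrDr mulr1.
apply: le_trans (_ : (`|\sum_s \sum_l \sum_i \tr (tau *m (x s l i *t adj (y s l i)))| +
  `|\tr (om *m (X' *t adj Y'))|) *+ 2 <= _).
  by rewrite lerMn2r ler_normD.
have le_lam (m n : nat) (rho : 'M[C]_(m * n)) (Z : 'M_m) (W : 'M_n) : psd rho ->
    \tr (ptraceB rho *m Z) = 0 -> \tr (ptraceA rho *m W) = 0 -> max_corr rho <= lam ->
    `|\tr (rho *m (Z *t adj W))| *+ 2 <=
    lam%:C%C * (\tr (ptraceB rho *m (Z *m adj Z)) + \tr (ptraceA rho *m (W *m adj W))).
  move=> prho Z0 W0 mu_le; apply: le_trans (corr_bound prho Z0 W0) _.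
  apply: ler_wpM2r; last by rewrite lecR.
  (* The sum of the two norms is nonnegative, since by [corr_cauchy] it dominates twice a
     modulus. *)
  by apply: le_trans (corr_cauchy Z W prho); rewrite mulrn_wge0.
rewrite mulrnDl mulrDr; apply: lerD; last first.
  by apply: le_lam => //; rewrite le_max lexx orbT.
apply: le_trans (_ : (\sum_s \sum_l \sum_i `|\tr (tau *m (x s l i *t adj (y s l i)))|) *+ 2 <= _).
  rewrite lerMn2r /=; do 2![apply: le_trans (ler_norm_sum _ _ _) _; apply: ler_sum => ? _].
  exact: ler_norm_sum.
do 3![rewrite mulr_sumr -sumrMnl; apply: ler_sum => ? _].
by apply: le_lam => //; rewrite ?center_mean // le_max lexx.
Qed.

(** * Density matrices under tensor product and regrouping *)

Lemma psd_sum (n : nat) (T : finType) (F : T -> 'M[C]_n) :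
  (forall t, psd (F t)) -> psd (\sum_t F t).
Proof.
move=> pF; split=> [|v].
  apply/matrixP => i j; rewrite adjE !summxE rmorph_sum; apply: eq_bigr => t _.
  by have [hF _] := pF t; rewrite /= -adjE hF.
rewrite mulmx_sumr mulmx_suml summxE; apply: sumr_ge0 => t _.
by have [_] := pF t.
Qed.

(** Selecting rows of a factor K gives a factor of the submatrix. This serves both [regroup] and the
    summands of [ptrace]. *)
Lemma psd_mxsub (m n : nat) (f : 'I_m -> 'I_n) (A : 'M[C]_n) :
  psd A -> psd (mxsub f f A).
Proof.
move=> /psd_factor[K ->].
have -> : mxsub f f (K *m adj K) = rowsub f K *m adj (rowsub f K).
  by apply/matrixP => i j; rewrite !mxE; apply: eq_bigr => k _; rewrite !mxE.
exact: psd_mul_adj.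
Qed.

Lemma psd_tens (m n : nat) (A : 'M[C]_m) (B : 'M[C]_n) :
  psd A -> psd B -> psd (A *t B).
Proof.
move=> /psd_factor[K ->] /psd_factor[L ->].
by rewrite -tensmx_mul -adj_tens; apply: psd_mul_adj.
Qed.

Lemma mxtrace_tens (m n : nat) (A : 'M[C]_m) (B : 'M[C]_n) :
  \tr (A *t B) = \tr A * \tr B.
Proof.
rewrite /mxtrace sum_mxtens big_distrlr /=.
by do 2![apply: eq_bigr => ? _]; rewrite tensmxE.
Qed.

Lemma density_regroup (a b a' b' : nat) (tau : 'M[C]_(a * b)) (om : 'M[C]_(a' * b')) :
  density tau -> density om -> density (regroup (tau *t om)).
Proof.
move=> [ptau trtau] [pom trom]; split; last first.
  by rewrite -tr_ptraceB1 ptraceB_tens mxtrace_tens !tr_ptraceB1 trtau trom mulr1.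
(* [regroup] reindexes rows and columns by the same map [f], so positivity is inherited from the
   tensor product. *)
pose f (x : 'I_((a * a') * (b * b'))) : 'I_((a * b) * (a' * b')) :=
  let: (ia, ib) := mxtens_unindex x in
  mxtens_index (mxtens_index ((mxtens_unindex ia).1, (mxtens_unindex ib).1),
                mxtens_index ((mxtens_unindex ia).2, (mxtens_unindex ib).2)).
have -> : regroup (tau *t om) = mxsub f f (tau *t om).
  by apply/matrixP => x y; rewrite [LHS]mxE [RHS]mxE.
by apply: psd_mxsub; apply: psd_tens.
Qed.

(** * Partial traces onto AB and A'B', and monotonicity of mu *)

Definition ptrace (p q : nat) (T : finType) (f : T -> 'I_p -> 'I_q) (M : 'M[C]_q) : 'M[C]_p :=
  \sum_t mxsub (f t) (f t) M.

Lemma ptraceE (p q : nat) (T : finType) (f : T -> 'I_p -> 'I_q) (M : 'M[C]_q) x y :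
  ptrace f M x y = \sum_t M (f t x) (f t y).
Proof. by rewrite summxE; apply: eq_bigr => t _; rewrite mxE. Qed.

Lemma ptrace_comb (p q k : nat) (T : finType) (f : T -> 'I_p -> 'I_q)
    (c : 'I_k -> C) (M : 'I_k -> 'M[C]_q) :
  ptrace f (\sum_i c i *: M i) = \sum_i c i *: ptrace f (M i).
Proof.
apply/matrixP => x y; rewrite ptraceE summxE.
under eq_bigr do rewrite summxE.
rewrite exchange_big; apply: eq_bigr => i _ /=.
by rewrite mxE ptraceE mulr_sumr; apply: eq_bigr => t _; rewrite mxE.
Qed.

Lemma psd_ptrace (p q : nat) (T : finType) (f : T -> 'I_p -> 'I_q) (M : 'M[C]_q) :
  psd M -> psd (ptrace f M).
Proof. by move=> pM; apply: psd_sum => t; apply: psd_mxsub. Qed.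

Section Factors.
Variables a b a' b' : nat.

(** [pos1 t] embeds the basis of AB next to the basis state t of A'B', so [ptrace pos1] traces out
    A'B'. Likewise [ptrace pos2] traces out AB. *)
Definition pos1 (t : 'I_a' * 'I_b') (x : 'I_(a * b)) : 'I_((a * a') * (b * b')) :=
  mxtens_index (mxtens_index ((mxtens_unindex x).1, t.1),
                mxtens_index ((mxtens_unindex x).2, t.2)).
Definition pos2 (t : 'I_a * 'I_b) (x : 'I_(a' * b')) : 'I_((a * a') * (b * b')) :=
  mxtens_index (mxtens_index (t.1, (mxtens_unindex x).1),
                mxtens_index (t.2, (mxtens_unindex x).2)).

Lemma ptrace1_tens (tau : 'M[C]_(a * b)) (om : 'M[C]_(a' * b')) :
  \tr om = 1 -> ptrace pos1 (regroup (tau *t om)) = tau.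
Proof.
move=> trom; apply/matrixP => x y; rewrite ptraceE.
case: (mxtens_indexP x) => i j; case: (mxtens_indexP y) => k l.
rewrite -[RHS]mulr1 -trom /mxtrace sum_mxtens pair_bigA mulr_sumr.
by apply: eq_bigr => -[i' j'] _; rewrite /pos1 !mxtens_indexK regroupE tensmxE.
Qed.

Lemma ptrace2_tens (tau : 'M[C]_(a * b)) (om : 'M[C]_(a' * b')) :
  \tr tau = 1 -> ptrace pos2 (regroup (tau *t om)) = om.
Proof.
move=> trtau; apply/matrixP => x y; rewrite ptraceE.
case: (mxtens_indexP x) => i j; case: (mxtens_indexP y) => k l.
rewrite -[RHS]mul1r -trtau /mxtrace sum_mxtens pair_bigA mulr_suml.
by apply: eq_bigr => -[i' j'] _; rewrite /pos2 !mxtens_indexK regroupE tensmxE.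
Qed.

Lemma sum_tens1r (m n : nat) (F : 'I_(m * n) -> C) (X : 'M[C]_m) i i' :
  \sum_K F K * (X *t (1%:M : 'M_n)) K (mxtens_index (i, i')) =
  \sum_k F (mxtens_index (k, i')) * X k i.
Proof.
rewrite sum_mxtens; apply: eq_bigr => k _.
rewrite (bigD1 i') //= big1 ?addr0 ?tensmxE ?mxE ?eqxx ?mulr1 // => k' /negPf ne.
by rewrite tensmxE mxE ne !mulr0.
Qed.

Lemma sum_tens1l (m n : nat) (F : 'I_(m * n) -> C) (X : 'M[C]_n) i i' :
  \sum_K F K * ((1%:M : 'M_m) *t X) K (mxtens_index (i, i')) =
  \sum_k F (mxtens_index (i, k)) * X k i'.
Proof.
rewrite sum_mxtens exchange_big; apply: eq_bigr => k _ /=.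
rewrite (bigD1 i) //= big1 ?addr0 ?tensmxE ?mxE ?eqxx ?mul1r // => k' /negPf ne.
by rewrite tensmxE mxE ne mul0r mulr0.
Qed.

(** Duality between tracing out A'B' and tensoring with the identity there: each identity forces the
    row and column indices of a traced factor to agree. *)
Lemma tr_ptrace1 (M : 'M[C]_((a * a') * (b * b'))) (X : 'M_a) (Y : 'M_b) :
  \tr (ptrace pos1 M *m (X *t Y)) = \tr (M *m ((X *t 1%:M) *t (Y *t 1%:M))).
Proof.
transitivity (\sum_i \sum_j \sum_i' \sum_j' \sum_k \sum_l
  M (mxtens_index (mxtens_index (i, i'), mxtens_index (j, j')))
    (mxtens_index (mxtens_index (k, i'), mxtens_index (l, j'))) * (X k i * Y l j)).
  rewrite tr_tens; do 2![apply: eq_bigr => ? _].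
  rewrite [RHS]pair_bigA -[RHS]exchange_big3; do 2![apply: eq_bigr => ? _].
  rewrite ptraceE mulr_suml; apply: eq_bigr => -[i' j'] _.
  by rewrite /pos1 !mxtens_indexK.
rewrite tr_tens sum_mxtens; apply: eq_bigr => i _.
rewrite exchange_big; apply: eq_bigr => i' _ /=.
rewrite sum_mxtens; do 2![apply: eq_bigr => ? _].
under [RHS]eq_bigr do (under eq_bigr do rewrite mulrCA; rewrite -mulr_sumr sum_tens1r mulrC).
rewrite sum_tens1r; apply: eq_bigr => k _.
by rewrite mulr_suml; apply: eq_bigr => l _; rewrite -mulrA [Y _ _ * _]mulrC.
Qed.

Lemma tr_ptrace2 (M : 'M[C]_((a * a') * (b * b'))) (X : 'M_a') (Y : 'M_b') :
  \tr (ptrace pos2 M *m (X *t Y)) = \tr (M *m ((1%:M *t X) *t (1%:M *t Y))).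
Proof.
transitivity (\sum_i' \sum_j' \sum_i \sum_j \sum_k \sum_l
  M (mxtens_index (mxtens_index (i, i'), mxtens_index (j, j')))
    (mxtens_index (mxtens_index (i, k), mxtens_index (j, l))) * (X k i' * Y l j')).
  rewrite tr_tens; do 2![apply: eq_bigr => ? _].
  rewrite [RHS]pair_bigA -[RHS]exchange_big3; do 2![apply: eq_bigr => ? _].
  rewrite ptraceE mulr_suml; apply: eq_bigr => -[i' j'] _.
  by rewrite /pos2 !mxtens_indexK.
rewrite tr_tens sum_mxtens [RHS]exchange_big; apply: eq_bigr => i' _ /=.
rewrite exchange_big; apply: eq_bigr => i _ /=.
rewrite sum_mxtens [RHS]exchange_big; do 2![apply: eq_bigr => ? _] => /=.
under [RHS]eq_bigr do (under eq_bigr do rewrite mulrCA; rewrite -mulr_sumr sum_tens1l mulrC).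
rewrite sum_tens1l; apply: eq_bigr => k _.
by rewrite mulr_suml; apply: eq_bigr => l _; rewrite -mulrA [Y _ _ * _]mulrC.
Qed.

End Factors.

(** [hA] and [hB] abstract the maps X |-> X (x) 1 and X |-> 1 (x) X, so that both partial traces are
    instances. They send an admissible pair for [rho] to an admissible pair for [rho'] with the same
    correlation. *)
Lemma max_corr_le (m n m' n' : nat) (rho : 'M[C]_(m * n)) (rho' : 'M[C]_(m' * n'))
    (hA : 'M[C]_m -> 'M[C]_m') (hB : 'M[C]_n -> 'M[C]_n') :
  psd rho' -> hA 1%:M = 1%:M -> hB 1%:M = 1%:M ->
  (forall X, hA (X *m adj X) = hA X *m adj (hA X)) ->
  (forall Y, hB (Y *m adj Y) = hB Y *m adj (hB Y)) ->
  (forall Y, hB (adj Y) = adj (hB Y)) ->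
  (forall X Y, \tr (rho *m (X *t Y)) = \tr (rho' *m (hA X *t hB Y))) ->
  max_corr rho <= max_corr rho'.
Proof.
move=> prho' hA1 hB1 hAM hBM hBJ tr_rho.
rewrite {1}/max_corr; have [->|/set0P ne] := eqVneq (corr_values rho) set0.
  by rewrite sup0 max_corr_ge0.
have trA X : \tr (ptraceB rho *m X) = \tr (ptraceB rho' *m hA X).
  by rewrite !tr_ptraceB tr_rho hB1.
have trB Y : \tr (ptraceA rho *m Y) = \tr (ptraceA rho' *m hB Y).
  by rewrite !tr_ptraceA tr_rho hA1.
apply: ge_sup => // _ [X [Y [EX EY NX NY ->]]].
apply: ub_le_sup; first by exists 1; exact: corr_values_le1.
exists (hA X), (hB Y); split; rewrite -?hAM -?hBM -?hBJ -?trA -?trB -?tr_rho //.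
Qed.

Lemma max_corr_ptrace1 (a b a' b' : nat) (tau : 'M[C]_((a * a') * (b * b'))) :
  psd tau -> max_corr (ptrace (@pos1 a b a' b') tau) <= max_corr tau.
Proof.
move=> ptau.
apply: (@max_corr_le _ _ _ _ _ _ (fun X => X *t 1%:M) (fun Y => Y *t 1%:M)) => //.
- exact: tens11.
- exact: tens11.
- by move=> X; rewrite adj_tens adj1 tensmx_mul mulmx1.
- by move=> X; rewrite adj_tens adj1 tensmx_mul mulmx1.
- by move=> X; rewrite adj_tens adj1.
- exact: tr_ptrace1.
Qed.

Lemma max_corr_ptrace2 (a b a' b' : nat) (tau : 'M[C]_((a * a') * (b * b'))) :
  psd tau -> max_corr (ptrace (@pos2 a b a' b') tau) <= max_corr tau.
Proof.
move=> ptau.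
apply: (@max_corr_le _ _ _ _ _ _ (fun X => 1%:M *t X) (fun Y => 1%:M *t Y)) => //.
- exact: tens11.
- exact: tens11.
- by move=> X; rewrite adj_tens adj1 tensmx_mul mulmx1.
- by move=> X; rewrite adj_tens adj1 tensmx_mul mulmx1.
- by move=> X; rewrite adj_tens adj1.
- exact: tr_ptrace2.
Qed.

Lemma density_ptrace1 (a b a' b' : nat) (tau : 'M[C]_((a * a') * (b * b'))) :
  density tau -> density (ptrace (@pos1 a b a' b') tau).
Proof.
move=> [ptau trtau]; split; first exact: psd_ptrace.
by rewrite -[ptrace _ _]mulmx1 -tens11 tr_ptrace1 !tens11 mulmx1.
Qed.

Lemma density_ptrace2 (a b a' b' : nat) (tau : 'M[C]_((a * a') * (b * b'))) :
  density tau -> density (ptrace (@pos2 a b a' b') tau).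
Proof.
move=> [ptau trtau]; split; first exact: psd_ptrace.
by rewrite -[ptrace _ _]mulmx1 -tens11 tr_ptrace2 !tens11 mulmx1.
Qed.

(** * Maximal entanglement as an infimum over decompositions *)

Lemma ment_values_lbound (m n : nat) (rho : 'M[C]_(m * n)) : lbound (ment_values rho) 0.
Proof. by move=> _ [k [p [tau [_ _ _ ->]]]]; exact: bigmax_ge_id. Qed.

Lemma ment_values_nonempty (m n : nat) (rho : 'M[C]_(m * n)) :
  density rho -> (ment_values rho !=set0)%classic.
Proof.
move=> drho; exists (\big[Num.max/0]_(i < 1) max_corr rho).
exists 1%N, (fun=> 1), (fun=> rho); split => //.
by rewrite big_ord1 rmorph1 scale1r.
Qed.

(** By linearity, [ptrace f] turns a decomposition of [rho] into one of [ptrace f rho] with the same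
    weights, and no term gains correlation. *)
Lemma max_ent_ptrace (m n m' n' : nat) (T : finType) (f : T -> 'I_(m * n) -> 'I_(m' * n'))
    (rho : 'M[C]_(m' * n')) : density rho ->
  (forall tau, density tau -> density (ptrace f tau)) ->
  (forall tau : 'M[C]_(m' * n'), psd tau ->
     max_corr (ptrace f tau : 'M[C]_(m * n)) <= max_corr tau) ->
  max_ent (ptrace f rho : 'M[C]_(m * n)) <= max_ent rho.
Proof.
move=> drho df mf; apply: lb_le_inf; first exact: ment_values_nonempty.
move=> _ [k [p [tau [p0 dtau -> ->]]]].
apply: le_trans (_ : \big[Num.max/0]_(i < k) max_corr (ptrace f (tau i) : 'M[C]_(m * n)) <= _).
  apply: ge_inf; first by exists 0; exact: ment_values_lbound.
  exists k, p, (fun i => ptrace f (tau i)); split => //;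
    [by move=> i; exact/df | exact: ptrace_comb].
apply: bigmax_le => [|i _]; first exact: bigmax_ge_id.
apply: le_trans (mf _ (dtau i).1) _.
exact: (le_bigmax _ (fun i => max_corr (tau i))).
Qed.

(** Decompositions within e of the two infima are tensored term by term, with weights p_i q_j, and
    [max_corr_tens] bounds each term. The slack e avoids assuming that the infima are attained. *)
Lemma max_ent_tens_le (a b a' b' : nat) (rho : 'M[C]_(a * b)) (sigma : 'M[C]_(a' * b')) :
  density rho -> density sigma ->
  max_ent (regroup (rho *t sigma)) <= Num.max (max_ent rho) (max_ent sigma).
Proof.
move=> drho dsigma; apply/ler_addgt0Pr => e e0.
have inf_rho : has_inf (ment_values rho).
  by split; [exact: ment_values_nonempty | exists 0; exact: ment_values_lbound].
have inf_sigma : has_inf (ment_values sigma).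
  by split; [exact: ment_values_nonempty | exists 0; exact: ment_values_lbound].
have [_ [k [p [tau [p0 dtau rhoE ->]]]] /ltW le_rho] := inf_adherent e0 inf_rho.
have [_ [l [q [om [q0 dom sigmaE ->]]]] /ltW le_sigma] := inf_adherent e0 inf_sigma.
rewrite addr_maxl.
apply: le_trans (_ : \big[Num.max/0]_(x < k * l)
  max_corr (regroup (tau (mxtens_unindex x).1 *t om (mxtens_unindex x).2)) <= _).
  apply: ge_inf; first by exists 0; exact: ment_values_lbound.
  exists (k * l)%N, (fun x => p (mxtens_unindex x).1 * q (mxtens_unindex x).2).
  eexists; split; last reflexivity.
  - by move=> x; rewrite mulr_ge0.
  - by move=> x; exact: density_regroup.
  apply/matrixP => x y.
  case: (mxtens_indexP x) => x1 x2; case: (mxtens_indexP y) => y1 y2.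
  case: (mxtens_indexP x1) => i i'; case: (mxtens_indexP x2) => j j'.
  case: (mxtens_indexP y1) => u u'; case: (mxtens_indexP y2) => v v'.
  rewrite regroupE tensmxE rhoE sigmaE !summxE sum_mxtens.
  under [RHS]eq_bigr do under eq_bigr do rewrite !mxtens_indexK.
  rewrite big_distrlr /=; do 2![apply: eq_bigr => ? _].
  by rewrite [RHS]mxE regroupE tensmxE !mxE rmorphM mulrACA.
apply: bigmax_le => [|x _].
  by rewrite le_max (le_trans _ le_rho) //; exact: bigmax_ge_id.
apply: le_trans (max_corr_tens (dtau _) (dom _)) _.
rewrite ge_max !le_max; apply/andP; split.
  by rewrite (le_trans _ le_rho) //; exact: (le_bigmax _ (fun i => max_corr (tau i))).
by rewrite (le_trans _ le_sigma) ?orbT //; exact: (le_bigmax _ (fun i => max_corr (om i))).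
Qed.

End Correlation.

Theorem theorem5 (R : realType) (dA dB dA' dB' : nat)
    (rho : 'M[R[i]]_(dA * dB)) (sigma : 'M[R[i]]_(dA' * dB')) :
  density rho -> density sigma ->
  max_ent (regroup (rho *t sigma)) = Num.max (max_ent rho) (max_ent sigma).
Proof.
move=> drho dsigma; apply/eqP; rewrite eq_le max_ent_tens_le //= ge_max.
have drs := density_regroup drho dsigma.
have [[_ trrho] [_ trsigma]] := (drho, dsigma).
apply/andP; split.
(* Since [sigma] has trace 1, [rho] is a partial trace of the regrouped product; the other case is
   symmetric. *)
- rewrite -{1}(ptrace1_tens rho trsigma); apply: max_ent_ptrace => //.
  + exact: density_ptrace1.
  + exact: max_corr_ptrace1.
- rewrite -{1}(ptrace2_tens sigma trrho); apply: max_ent_ptrace => //.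
  + exact: density_ptrace2.
  + exact: max_corr_ptrace2.
Qed.
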